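(* Let $A=\begin{bmatrix}a&b\\ c&d\end{bmatrix}$ be a $2\times2$ quaternionic matrix with $b\neq0$, and let $\mu(\lambda)=c-(d-\lambda)b^{-1}(a-\lambda)$. Then $\mu(A)=0$, that is, $$cI-(dI-A)(b^{-1}I)(aI-A)=0.$$
   Context: $\mathbb{H}$ is the algebra of quaternions and $I$ is the $2\times2$ identity matrix. For a quaternionic polynomial $\mu(\lambda)$, the matrix $\mu(A)$ is obtained by replacing $\lambda$ by $A$ and each quaternion $q$ by the matrix $qI$. (The function $\mu$ above is the characteristic function the paper associates with $A$ when $b\neq0$.) *)

(* Defs.v *)
From HB Require Import structures.
From mathcomp Require Import all_boot all_order all_algebra.
From mathcomp Require Import ring lra reals.

Set Implicit Arguments.
Unset Strict Implicit.
Unset Printing Implicit Defensive.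

Import Order.TTheory GRing.Theory Num.Theory.
Local Open Scope ring_scope.

(* Quat x y z t stands for x + y i + z j + t k. *)
Record quat (R : Type) : Type := Quat { qre : R; qi : R; qj : R; qk : R }.

Section QuatChoice.
Variable R : Type.

Definition quat_to_prod (q : quat R) : R * R * R * R :=
  (qre q, qi q, qj q, qk q).
Definition quat_of_prod (p : R * R * R * R) : quat R :=
  let: (x, y, z, t) := p in Quat x y z t.

Lemma quat_to_prodK : cancel quat_to_prod quat_of_prod.
Proof. by case. Qed.
End QuatChoice.

HB.instance Definition _ (R : eqType) :=
  Equality.copy (quat R) (can_type (@quat_to_prodK R)).
HB.instance Definition _ (R : choiceType) :=
  Choice.copy (quat R) (can_type (@quat_to_prodK R)).

Section QuatRing.
Variable R : realFieldType.
Implicit Types p q : quat R.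

Definition zeroq : quat R := Quat 0 0 0 0.
Definition oneq : quat R := Quat 1 0 0 0.
Definition oppq q : quat R := Quat (- qre q) (- qi q) (- qj q) (- qk q).
Definition addq p q : quat R :=
  Quat (qre p + qre q) (qi p + qi q) (qj p + qj q) (qk p + qk q).

(* Hamilton product: i^2 = j^2 = k^2 = ijk = -1. *)
Definition mulq p q : quat R :=
  Quat (qre p * qre q - qi p * qi q - qj p * qj q - qk p * qk q)
       (qre p * qi q + qi p * qre q + qj p * qk q - qk p * qj q)
       (qre p * qj q - qi p * qk q + qj p * qre q + qk p * qi q)
       (qre p * qk q + qi p * qj q - qj p * qi q + qk p * qre q).

Definition sqnormq q : R := qre q ^+ 2 + qi q ^+ 2 + qj q ^+ 2 + qk q ^+ 2.

(* conj q / |q|^2, so that the inverse of 0 is 0. *)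
Definition invq q : quat R :=
  Quat (qre q / sqnormq q) (- qi q / sqnormq q)
       (- qj q / sqnormq q) (- qk q / sqnormq q).

Fact addqA : associative addq.
Proof. by move=> [? ? ? ?] [? ? ? ?] [? ? ? ?]; rewrite /addq /= !addrA. Qed.
Fact addqC : commutative addq.
Proof. by move=> [? ? ? ?] [? ? ? ?]; congr Quat; rewrite /= addrC. Qed.
Fact add0q : left_id zeroq addq.
Proof. by move=> [? ? ? ?]; rewrite /addq /= !add0r. Qed.
Fact addNq : left_inverse zeroq oppq addq.
Proof. by move=> [? ? ? ?]; rewrite /addq /= !addNr. Qed.

HB.instance Definition _ :=
  GRing.isZmodule.Build (quat R) addqA addqC add0q addNq.

Fact mulqA : associative mulq.
Proof. by move=> [? ? ? ?] [? ? ? ?] [? ? ? ?]; congr Quat => /=; ring. Qed.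
Fact mul1q : left_id oneq mulq.
Proof. by move=> [? ? ? ?]; congr Quat => /=; ring. Qed.
Fact mulq1 : right_id oneq mulq.
Proof. by move=> [? ? ? ?]; congr Quat => /=; ring. Qed.
Fact mulqDl : left_distributive mulq addq.
Proof. by move=> [? ? ? ?] [? ? ? ?] [? ? ? ?]; congr Quat => /=; ring. Qed.
Fact mulqDr : right_distributive mulq addq.
Proof. by move=> [? ? ? ?] [? ? ? ?] [? ? ? ?]; congr Quat => /=; ring. Qed.
Fact oneq_neq0 : oneq != zeroq.
Proof. by apply/eqP => -[/eqP]; rewrite oner_eq0. Qed.

HB.instance Definition _ := GRing.Zmodule_isNzRing.Build (quat R)
  mulqA mul1q mulq1 mulqDl mulqDr oneq_neq0.

Lemma sqnormq_eq0 q : (sqnormq q == 0) = (q == 0).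
Proof.
apply/eqP/eqP => [|->]; last by rewrite /sqnormq /= expr0n /= !addr0.
case: q => x y z t; rewrite /sqnormq /= => h.
have [hx hy hz ht] : [/\ x ^+ 2 = 0, y ^+ 2 = 0, z ^+ 2 = 0 & t ^+ 2 = 0].
  by have := (sqr_ge0 x, sqr_ge0 y, sqr_ge0 z, sqr_ge0 t);
     case=> [[[? ?] ?] ?]; split; lra.
by congr Quat; apply/eqP; rewrite -sqrf_eq0; apply/eqP.
Qed.

Definition unitq : pred (quat R) := fun q => q != 0.

Fact mulVq : {in unitq, left_inverse 1 invq *%R}.
Proof.
move=> q; rewrite -topredE /= /unitq -sqnormq_eq0.
by case: q => x y z t; rewrite /sqnormq /= => h; congr Quat => /=;
  rewrite /sqnormq /=; field.
Qed.

Fact mulqV : {in unitq, right_inverse 1 invq *%R}.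
Proof.
move=> q; rewrite -topredE /= /unitq -sqnormq_eq0.
by case: q => x y z t; rewrite /sqnormq /= => h; congr Quat => /=;
  rewrite /sqnormq /=; field.
Qed.

Fact unitqP p q : q * p = 1 /\ p * q = 1 -> unitq p.
Proof.
by case=> qp1 _; apply/eqP => p0; move: qp1; rewrite p0 mulr0 => /esym/eqP;
  rewrite oner_eq0.
Qed.

Fact invq_out : {in [predC unitq], invq =1 id}.
Proof.
move=> q; rewrite inE -topredE /= negbK => /eqP ->.
by congr Quat; rewrite /= ?oppr0 mul0r.
Qed.

HB.instance Definition _ := GRing.NzRing_hasMulInverse.Build (quat R)
  mulVq mulqV unitqP invq_out.

Lemma unitqE q : (q \is a GRing.unit) = (q != 0).
Proof. by []. Qed.

End QuatRing.

(* Quaternionic polynomials in one variable: the variable does not commute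
   with the quaternion coefficients, and coefficients may occur on either side
   of it and between two occurrences of it.  They are kept as expressions so
   that the variable can be replaced by a matrix. *)
Inductive qpoly (R : Type) : Type :=
| QConst of quat R
| QVar
| QAdd of qpoly R & qpoly R
| QSub of qpoly R & qpoly R
| QMul of qpoly R & qpoly R.

Arguments QVar {R}.

Fixpoint qpoly_eval (R : Type) (S : pzRingType) (f : quat R -> S) (x : S)
    (p : qpoly R) : S :=
  match p with
  | QConst q => f q
  | QVar => x
  | QAdd p1 p2 => qpoly_eval f x p1 + qpoly_eval f x p2
  | QSub p1 p2 => qpoly_eval f x p1 - qpoly_eval f x p2
  | QMul p1 p2 => qpoly_eval f x p1 * qpoly_eval f x p2
  end.

Section Evaluation.
Variable R : realFieldType.

Definition qpoly_at (p : qpoly R) (l : quat R) : quat R :=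
  qpoly_eval id l p.

Definition qpoly_mx (p : qpoly R) (A : 'M[quat R]_2) : 'M[quat R]_2 :=
  qpoly_eval (fun q => q%:M) A p.

Definition mx2 (a b c d : quat R) : 'M[quat R]_2 :=
  block_mx (a%:M : 'M_1) (b%:M : 'M_1) (c%:M : 'M_1) (d%:M : 'M_1).

Definition mu (a b c d : quat R) : qpoly R :=
  QSub (QConst c)
       (QMul (QMul (QSub (QConst d) QVar) (QConst b^-1))
             (QSub (QConst a) QVar)).

Lemma mu_at (a b c d l : quat R) :
  qpoly_at (mu a b c d) l = c - (d - l) * b^-1 * (a - l).
Proof. by []. Qed.

Lemma mx2E (a b c d : quat R) :
  [/\ mx2 a b c d 0 0 = a, mx2 a b c d 0 1 = b,
      mx2 a b c d 1 0 = c & mx2 a b c d 1 1 = d].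
Proof.
by split; rewrite mxE; case: splitP => i; rewrite ?(ord1 i) //= => _;
  rewrite mxE; case: splitP => j; rewrite ?(ord1 j) //= => _; rewrite mxE.
Qed.

End Evaluation.

(* Main.v *)
Require Import Defs.
From mathcomp Require Import all_boot all_order all_algebra.
From mathcomp Require Import reals.
Import GRing.Theory.
Local Open Scope ring_scope.

(** Subtracting [A] kills the last diagonal entry of [d%:M - A] and the first of [a%:M - A]. In the
    triple product every [b] then meets [b^-1] directly, so nothing has to commute and [c%:M] is
    left. *)

Lemma mx2_scalar (R : realFieldType) (a : quat R) : a%:M = mx2 a 0 0 a.
Proof. by rewrite /mx2 raddf0 -scalar_mx_block. Qed.

Lemma mx2_sub (R : realFieldType) (a b c d a' b' c' d' : quat R) :
  mx2 a b c d - mx2 a' b' c' d' = mx2 (a - a') (b - b') (c - c') (d - d').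
Proof.
(* The explicit block sizes make 2 be read as 1 + 1. *)
by rewrite /mx2 [- _](@opp_block_mx _ 1 1 1 1) [LHS](@add_block_mx _ 1 1 1 1) -!raddfB.
Qed.

Lemma mx2_mul (R : realFieldType) (a b c d a' b' c' d' : quat R) :
  mx2 a b c d *m mx2 a' b' c' d' =
  mx2 (a * a' + b * c') (a * b' + b * d') (c * a' + d * c') (c * b' + d * d').
Proof. by rewrite /mx2 [LHS](@mulmx_block _ 1 1 1 1 1 1) -!scalar_mxM -!raddfD. Qed.

Theorem theorem6p1 (R : realType) (a b c d : quat R) (hb : b != 0) :
  let A : 'M[quat R]_2 := mx2 a b c d in
  qpoly_mx (mu a b c d) A = 0 /\
  c%:M - (d%:M - A) *m (b^-1)%:M *m (a%:M - A) = 0.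
Proof.
move=> A.
have bU : b \is a GRing.unit by rewrite unitqE.
suff E : c%:M = (d%:M - A) *m (b^-1)%:M *m (a%:M - A).
  have muA0 : c%:M - (d%:M - A) *m (b^-1)%:M *m (a%:M - A) = 0.
    by rewrite -E subrr.
  (* Evaluating [mu] at [A] unfolds to exactly this matrix expression. *)
  by split.
rewrite /A !mx2_scalar !mx2_sub !mx2_mul.
rewrite !(subrr, sub0r, mulr0, mul0r, addr0, add0r, mulNr, mulrN, opprK).
(* Both diagonal entries cancel to [c]; the upper right one becomes [- (d - a) - (a - d)], which is
   0. *)
by rewrite mulrV // !mul1r !mulrVK // opprB subrr oppr0.
Qed.
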